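(* Let $H$ be a weak Hopf algebra over a field $\Bbbk$, let $C$ be a $\Bbbk$-coalgebra, and let $h\in H$. Then $C$ is a (left) $H$-comodule coalgebra via the map $\rho_h:C\to H\otimes C$, $\rho_h(c)=h\otimes c$, if and only if (i) $\varepsilon_H(h)=1_{\Bbbk}$; (ii) $h^2=h$; (iii) $\Delta_H(h)=h\otimes h$.
   Context: All tensor products are over the field $\Bbbk$, all maps are $\Bbbk$-linear, and $V\otimes\Bbbk\simeq V\simeq\Bbbk\otimes V$ is used as an identification; coalgebras are coassociative and counital; Sweedler notation $\Delta(h)=h_1\otimes h_2$ is used, and $\tau_{V,W}:V\otimes W\to W\otimes V$ is the flip. $I_V$ is the identity map of $V$, and $m_H$ is the multiplication of $H$. A weak bialgebra $(H,m,u,\Delta,\varepsilon)$ is a vector space that is both an algebra and a coalgebra such that for all $h,k,\ell\in H$: (i) $\Delta(hk)=\Delta(h)\Delta(k)$; (ii) $\varepsilon(hk\ell)=\varepsilon(hk_1)\varepsilon(k_2\ell)=\varepsilon(hk_2)\varepsilon(k_1\ell)$; (iii) $(1_H\otimes\Delta(1_H))(\Delta(1_H)\otimes 1_H)=(\Delta(1_H)\otimes 1_H)(1_H\otimes\Delta(1_H))=\Delta^2(1_H)$, where $\Delta^2=(\Delta\otimes I)\Delta$. With $\Delta(1_H)=1_1\otimes 1_2$, define $\varepsilon_t(h)=\varepsilon(1_1h)1_2$ and $\varepsilon_s(h)=1_1\varepsilon(h1_2)$. A weak Hopf algebra is a weak bialgebra with a linear map $S:H\to H$ (antipode) such that $h_1S(h_2)=\varepsilon_t(h)$,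 $S(h_1)h_2=\varepsilon_s(h)$, $S(h_1)h_2S(h_3)=S(h)$ for all $h\in H$. A coalgebra $C$ is a (left) $H$-comodule coalgebra via a linear map $\rho:C\to H\otimes C$ if for all $c\in C$: (CC1) $(\varepsilon_H\otimes I_C)\rho(c)=c$; (CC2) $(I_H\otimes\Delta_C)\rho(c)=(m_H\otimes I_C\otimes I_C)(I_H\otimes\tau_{C,H}\otimes I_C)(\rho\otimes\rho)\Delta_C(c)$; (CC3) $(I_H\otimes\rho)\rho(c)=(\Delta_H\otimes I_C)\rho(c)$; (CC4) $(I_H\otimes\varepsilon_C)\rho(c)=(\varepsilon_t\otimes\varepsilon_C)\rho(c)$.
   Formalization: The coalgebra C is assumed to be nonzero: for C = 0 every map ρ_h, for instance with h = 0, is trivially a comodule coalgebra structure, while ε_H(0) = 0 ≠ 1, so the equivalence as stated fails there. *)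

(* Defs.v *)
From HB Require Import structures.
From mathcomp Require Import all_boot all_order all_algebra.
From mathcomp Require Import boolp.

Set Implicit Arguments.
Unset Strict Implicit.
Unset Printing Implicit Defensive.

Import GRing.Theory.
Local Open Scope ring_scope.
Local Open Scope quotient_scope.

Reserved Notation "V ⊗ W" (at level 40, left associativity).
Reserved Notation "x ∙ y" (at level 40, left associativity).

(* The tensor product V ⊗ W is the quotient of the formal sums                *)
(* v_1 ⊗ w_1 + ... + v_n ⊗ w_n, coded as sequences of pairs, by the           *)
(* congruence that makes ⊗ bilinear. The lemmas tens_is_bilinear, tlift_tens, *)
(* tlift_is_linear and linear_tensP give its universal property.              *)
Section TensorConstruction.
Context {K : fieldType} {V W : lmodType K}.
Implicit Types s t : seq (V * W).

Inductive tensor_rel : seq (V * W) -> seq (V * W) -> Prop :=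
| TensorRefl s : tensor_rel s s
| TensorSym s t : tensor_rel s t -> tensor_rel t s
| TensorTrans s t r : tensor_rel s t -> tensor_rel t r -> tensor_rel s r
| TensorCat s s' t t' :
    tensor_rel s s' -> tensor_rel t t' -> tensor_rel (s ++ t) (s' ++ t')
| TensorCatC s t : tensor_rel (s ++ t) (t ++ s)
| Tensor0l w : tensor_rel [:: (0, w)] [::]
| TensorDl u v w : tensor_rel [:: (u + v, w)] [:: (u, w); (v, w)]
| TensorDr v w x : tensor_rel [:: (v, w + x)] [:: (v, w); (v, x)]
| TensorZ a v w : tensor_rel [:: (a *: v, w)] [:: (v, a *: w)].

Definition tensor_relb : rel (seq (V * W)) := fun s t => `[< tensor_rel s t >].

Lemma tensor_relb_refl : reflexive tensor_relb.
Proof. by move=> s; apply/asboolP/TensorRefl. Qed.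

Lemma tensor_relb_sym : symmetric tensor_relb.
Proof. by move=> s t; apply/asboolP/asboolP => /TensorSym. Qed.

Lemma tensor_relb_trans : transitive tensor_relb.
Proof.
by move=> t s r /asboolP st /asboolP tr; apply/asboolP/(TensorTrans st tr).
Qed.

Canonical tensor_equiv :=
  EquivRel tensor_relb tensor_relb_refl tensor_relb_sym tensor_relb_trans.

End TensorConstruction.

Definition tensor (K : fieldType) (V W : lmodType K) : Type :=
  {eq_quot (@tensor_equiv K V W)}.

HB.instance Definition _ (K : fieldType) (V W : lmodType K) :=
  Choice.copy (tensor V W) {eq_quot (@tensor_equiv K V W)}.
HB.instance Definition _ (K : fieldType) (V W : lmodType K) :=
  EqQuotient.copy (tensor V W) {eq_quot (@tensor_equiv K V W)}.

Notation "V ⊗ W" := (tensor V W) : type_scope.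

Section TensorModule.
Context {K : fieldType} {V W : lmodType K}.
Implicit Types (s t r : seq (V * W)) (x y z : V ⊗ W).

Definition tclass s : V ⊗ W := \pi s.

Lemma tclassP s t : reflect (tensor_rel s t) (tclass s == tclass t).
Proof. by rewrite /tclass eqmodE; apply/asboolP. Qed.

Lemma tclass_eq s t : tensor_rel s t -> tclass s = tclass t.
Proof. by move/tclassP/eqP. Qed.

Lemma tclass_repr x : tclass (repr x) = x. Proof. exact: reprK. Qed.

Lemma repr_tclass s : tensor_rel (repr (tclass s)) s.
Proof. by apply/tclassP; rewrite tclass_repr. Qed.

Definition tadd x y := tclass (repr x ++ repr y).
Definition tscale (a : K) x := tclass [seq (a *: p.1, p.2) | p <- repr x].

Lemma taddE s t : tadd (tclass s) (tclass t) = tclass (s ++ t).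
Proof. by apply/tclass_eq/TensorCat; apply: repr_tclass. Qed.

Lemma tensor_rel_scale a s t : tensor_rel s t ->
  tensor_rel [seq (a *: p.1, p.2) | p <- s] [seq (a *: p.1, p.2) | p <- t].
Proof.
elim=> {s t} /= [s|s t _ IH|s t r _ IH1 _ IH2|s s' t t' _ IH1 _ IH2|s t|w|
  u v w|v w x|b v w].
- exact: TensorRefl.
- exact: TensorSym.
- exact: TensorTrans IH1 IH2.
- by rewrite !map_cat; apply: TensorCat.
- by rewrite !map_cat; apply: TensorCatC.
- by rewrite scaler0; apply: Tensor0l.
- by rewrite scalerDr; apply: TensorDl.
- exact: TensorDr.
- by rewrite scalerA mulrC -scalerA; apply: TensorZ.
Qed.

Lemma tscaleE a s :
  tscale a (tclass s) = tclass [seq (a *: p.1, p.2) | p <- s].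
Proof. by apply/tclass_eq/tensor_rel_scale/repr_tclass. Qed.

Lemma tclass_ind (P : V ⊗ W -> Prop) : (forall s, P (tclass s)) -> forall x, P x.
Proof. by move=> Ps x; rewrite -(tclass_repr x). Qed.

Lemma taddA : associative tadd.
Proof.
elim/tclass_ind=> s; elim/tclass_ind=> t; elim/tclass_ind=> r.
by rewrite !taddE catA.
Qed.

Lemma taddC : commutative tadd.
Proof.
elim/tclass_ind=> s; elim/tclass_ind=> t.
by rewrite !taddE; apply/tclass_eq/TensorCatC.
Qed.

Lemma tadd0 : left_id (tclass [::]) tadd.
Proof. by elim/tclass_ind=> s; rewrite taddE. Qed.

Lemma tscale0 x : tscale 0 x = tclass [::].
Proof.
elim/tclass_ind: x => s; rewrite tscaleE; apply/tclass_eq.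
elim: s => [|[v w] s IH] /=; first exact: TensorRefl.
rewrite scale0r -cat1s -[X in tensor_rel _ X]cat0s.
by apply: TensorCat => //; apply: Tensor0l.
Qed.

Lemma tscale1 : left_id 1 tscale.
Proof.
elim/tclass_ind=> s; rewrite tscaleE.
by congr tclass; rewrite -[RHS]map_id; apply: eq_map => -[v w]; rewrite scale1r.
Qed.

Lemma tscaleA a b x : tscale a (tscale b x) = tscale (a * b) x.
Proof.
elim/tclass_ind: x => s; rewrite !tscaleE -map_comp.
by congr tclass; apply: eq_map => -[v w] /=; rewrite scalerA.
Qed.

Lemma tscaleDr : right_distributive tscale tadd.
Proof.
move=> a; elim/tclass_ind=> s; elim/tclass_ind=> t.
by rewrite taddE !tscaleE taddE map_cat.
Qed.

Lemma tscaleDl x : {morph tscale^~ x : a b / a + b >-> tadd a b}.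
Proof.
move=> a b; elim/tclass_ind: x => s; rewrite !tscaleE.
elim: s => [|[v w] s IH] /=; first by rewrite taddE.
have cons_tclass p r : tclass (p :: r) = tadd (tclass [:: p]) (tclass r).
  by rewrite taddE.
rewrite (cons_tclass _ (map _ s)) IH scalerDl (tclass_eq (TensorDl _ _ _)).
rewrite !taddE /=; apply/tclass_eq.
rewrite -cat1s -[X in tensor_rel _ X]cat1s.
apply: TensorCat; first exact: TensorRefl.
rewrite -cat1s catA -[X in tensor_rel _ (_ ++ X)]cat1s catA.
by apply: TensorCat; [apply: TensorCatC|apply: TensorRefl].
Qed.

Lemma taddN : left_inverse (tclass [::]) (tscale (-1)) tadd.
Proof. by move=> x; rewrite -{2}(tscale1 x) -tscaleDl addNr tscale0. Qed.

HB.instance Definition _ :=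
  GRing.isZmodule.Build (V ⊗ W) taddA taddC tadd0 taddN.
HB.instance Definition _ :=
  GRing.Zmodule_isLmodule.Build K (V ⊗ W) tscaleA tscale1 tscaleDr tscaleDl.

Definition tens (v : V) (w : W) : V ⊗ W := tclass [:: (v, w)].

Lemma tens_is_bilinear : bilinear_for *:%R *:%R tens.
Proof.
have tensZ a v w : tens (a *: v) w = a *: tens v w.
  by rewrite [RHS]tscaleE.
split=> [w a u v|v a w x] /=; rewrite -?tensZ [RHS]taddE.
- exact/tclass_eq/TensorDl.
- apply/tclass_eq/(TensorTrans (TensorDr _ _ _)).
  exact: (TensorCat (s := [:: _]) (s' := [:: _])
            (TensorSym (TensorZ _ _ _)) (TensorRefl _)).
Qed.

Lemma tclass_sum s : tclass s = \sum_(p <- s) tens p.1 p.2.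
Proof.
elim: s => [|[v w] s IH]; first by rewrite big_nil.
by rewrite big_cons -IH [RHS]taddE.
Qed.

Lemma tens_ind (P : V ⊗ W -> Prop) :
    (forall v w, P (tens v w)) -> P 0 -> (forall x y, P x -> P y -> P (x + y)) ->
  forall x, P x.
Proof.
move=> Pt P0 PD; elim/tclass_ind=> s; rewrite tclass_sum.
by elim/big_ind: _.
Qed.

Lemma tens_sumP x : exists s, x = \sum_(p <- s) tens p.1 p.2.
Proof. by exists (repr x); rewrite -tclass_sum tclass_repr. Qed.

End TensorModule.

Arguments tclass_ind [K V W] P.
Arguments tens_ind [K V W] P.

Notation "v ⊗ w" := (tens v w) : ring_scope.

HB.instance Definition _ (K : fieldType) (V W : lmodType K) :=
  bilinear_isBilinear.Build K V W (V ⊗ W)%type *:%R *:%R tens tens_is_bilinear.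

HB.instance Definition _ (K : fieldType) (V W : lmodType K) (v : V) :=
  GRing.isLinear.Build K W (V ⊗ W)%type *:%R (tens v)
    ((@tens_is_bilinear K V W).2 v).

(* The linear map V ⊗ W -> U induced by f : V -> W -> U; it is meaningful     *)
(* only for a bilinear f. It renders Sweedler notation: if x = h_1 ⊗ h_2,     *)
(* then tlift f x is f h_1 h_2.                                               *)
Definition tlift (K : fieldType) (V W U : lmodType K) (f : V -> W -> U)
  (x : V ⊗ W) : U := \sum_(p <- repr x) f p.1 p.2.

Section TensorLift.
Context {K : fieldType} {V W U : lmodType K}.

Lemma tensZl a (v : V) (w : W) : (a *: v) ⊗ w = a *: (v ⊗ w).
Proof. by have /= := linearZl_LR tens w a v. Qed.

Lemma tensZr a (v : V) (w : W) : v ⊗ (a *: w) = a *: (v ⊗ w).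
Proof. exact: linearZ. Qed.

Lemma tensDl (v v' : V) (w : W) : (v + v') ⊗ w = v ⊗ w + v' ⊗ w.
Proof. by have /= := linearDl tens w v v'. Qed.

Lemma tensDr (v : V) (w w' : W) : v ⊗ (w + w') = v ⊗ w + v ⊗ w'.
Proof. exact: linearD. Qed.

Lemma linear_tensP (f g : {linear (V ⊗ W)%type -> U}) :
  (forall v w, f (v ⊗ w) = g (v ⊗ w)) -> f =1 g.
Proof.
move=> fg x; elim/tens_ind: x => [//||x y fx fy]; first by rewrite !linear0.
by rewrite !linearD fx fy.
Qed.

Section Bilinear.
Context {f : V -> W -> U}.
Hypothesis bf : bilinear_for *:%R *:%R f.

Lemma tensor_rel_sum s t : tensor_rel s t ->
  \sum_(p <- s) f p.1 p.2 = \sum_(p <- t) f p.1 p.2.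
Proof.
case: bf => fl fr; pose fE := (big_cat, big_seq1, big_nil, big_cons).
have fZl w a v : f (a *: v) w = a *: f v w.
  exact: (GRing.scalable_linear (fl w)).
have fZr w a v : f v (a *: w) = a *: f v w.
  exact: (GRing.scalable_linear (fr v)).
elim=> {s t} /= [s|s t _ IH|s t r _ IH1 _ IH2|s s' t t' _ IH1 _ IH2|s t|w|
  u v w|v w x|b v w] //; rewrite ?fE /=.
- by rewrite IH1.
- by rewrite IH1 IH2.
- by rewrite addrC.
- by rewrite addr0 -(scale0r (0 : V)) fZl scale0r.
- by rewrite !addr0; have /= := fl w 1 u v; rewrite !scale1r.
- by rewrite !addr0; have /= := fr v 1 w x; rewrite !scale1r.
- by rewrite !addr0 fZl fZr.
Qed.

Lemma tlift_tclass s : tlift f (tclass s) = \sum_(p <- s) f p.1 p.2.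
Proof. exact/tensor_rel_sum/repr_tclass. Qed.

Lemma tlift_tens v w : tlift f (v ⊗ w) = f v w.
Proof. by rewrite tlift_tclass big_seq1. Qed.

Lemma tlift_is_linear : GRing.linear_for *:%R (tlift f).
Proof.
move=> a; elim/tclass_ind=> s; elim/tclass_ind=> t.
rewrite [a *: _]tscaleE [X in tlift f X]taddE !tlift_tclass big_cat big_map.
rewrite scaler_sumr; congr (_ + _); apply: eq_bigr => p _ /=.
exact: (GRing.scalable_linear (bf.1 p.2)).
Qed.

End Bilinear.
End TensorLift.

Section TensorMaps.
Context {K : fieldType}.
Implicit Types A B C D : lmodType K.

Definition tmap A B C D (f : A -> C) (g : B -> D) : (A ⊗ B)%type -> (C ⊗ D)%type :=
  tlift (fun a b => f a ⊗ g b).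

Lemma tmap_is_bilinear A B C D (f : {linear A -> C}) (g : {linear B -> D}) :
  bilinear_for *:%R *:%R (fun a b => f a ⊗ g b).
Proof. by split=> [b k a a'|a k b b'] /=; rewrite linearP ?tensDl ?tensZl // linearP. Qed.

HB.instance Definition _ A B C D (f : {linear A -> C}) (g : {linear B -> D}) :=
  GRing.isLinear.Build K (A ⊗ B)%type (C ⊗ D)%type *:%R (tmap f g)
    (tlift_is_linear (tmap_is_bilinear f g)).

Lemma tmapE A B C D (f : {linear A -> C}) (g : {linear B -> D}) a b :
  tmap f g (a ⊗ b) = f a ⊗ g b.
Proof. exact: (tlift_tens (tmap_is_bilinear f g)). Qed.

Definition tflip A B : (A ⊗ B)%type -> (B ⊗ A)%type := tlift (fun a b => b ⊗ a).

Lemma tflip_is_bilinear A B :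
  bilinear_for *:%R *:%R (fun (a : A) (b : B) => b ⊗ a).
Proof. by split=> [b k a a'|a k b b'] /=; rewrite ?tensDl ?tensZl ?tensDr ?tensZr. Qed.

HB.instance Definition _ A B :=
  GRing.isLinear.Build K (A ⊗ B)%type (B ⊗ A)%type *:%R (@tflip A B)
    (tlift_is_linear (tflip_is_bilinear A B)).

Lemma tflipE A B (a : A) (b : B) : tflip (a ⊗ b) = b ⊗ a.
Proof. exact: (tlift_tens (tflip_is_bilinear A B)). Qed.

(* The identification k ⊗ V = V. *)
Definition tlunit A : (K^o ⊗ A)%type -> A := tlift (fun (k : K^o) a => k *: a).
Definition trunit A : (A ⊗ K^o)%type -> A := tlift (fun a (k : K^o) => k *: a).

Lemma tlunit_is_bilinear A :
  bilinear_for *:%R *:%R (fun (k : K^o) (a : A) => k *: a).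
Proof.
split=> [a l k k'|k l a a'] /=; first by rewrite scalerDl -scalerA.
by rewrite scalerDr !scalerA mulrC.
Qed.

Lemma trunit_is_bilinear A :
  bilinear_for *:%R *:%R (fun (a : A) (k : K^o) => k *: a).
Proof. by split; case: (tlunit_is_bilinear A). Qed.

HB.instance Definition _ A :=
  GRing.isLinear.Build K (K^o ⊗ A)%type A *:%R (@tlunit A)
    (tlift_is_linear (tlunit_is_bilinear A)).
HB.instance Definition _ A :=
  GRing.isLinear.Build K (A ⊗ K^o)%type A *:%R (@trunit A)
    (tlift_is_linear (trunit_is_bilinear A)).

Lemma tlunitE A (k : K) (a : A) : tlunit ((k : K^o) ⊗ a) = k *: a.
Proof. exact: (tlift_tens (tlunit_is_bilinear A)). Qed.
Lemma trunitE A (k : K) (a : A) : trunit (a ⊗ (k : K^o)) = k *: a.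
Proof. exact: (tlift_tens (trunit_is_bilinear A)). Qed.

(* The identification (A ⊗ B) ⊗ C = A ⊗ (B ⊗ C), in both directions. *)
Definition tassoc A B C : ((A ⊗ B) ⊗ C)%type -> (A ⊗ (B ⊗ C))%type :=
  tlift (fun x c => tlift (fun a b => a ⊗ (b ⊗ c)) x).
Definition tassocV A B C : (A ⊗ (B ⊗ C))%type -> ((A ⊗ B) ⊗ C)%type :=
  tlift (fun a y => tlift (fun b c => (a ⊗ b) ⊗ c) y).

Lemma tassoc_in_is_bilinear A B C (c : C) :
  bilinear_for *:%R *:%R (fun (a : A) (b : B) => a ⊗ (b ⊗ c)).
Proof. by split=> [b k a a'|a k b b'] /=; rewrite ?(tensDl, tensZl, tensDr, tensZr). Qed.

Lemma tassoc_is_bilinear A B C : bilinear_for *:%R *:%R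
  (fun (x : (A ⊗ B)%type) (c : C) => tlift (fun a b => a ⊗ (b ⊗ c)) x).
Proof.
split=> [c|x k c c'] /=; first exact/tlift_is_linear/tassoc_in_is_bilinear.
rewrite /tlift scaler_sumr -big_split /=; apply: eq_bigr => p _.
by rewrite !(tensDr, tensZr).
Qed.

Lemma tassocV_in_is_bilinear A B C (a : A) :
  bilinear_for *:%R *:%R (fun (b : B) (c : C) => (a ⊗ b) ⊗ c).
Proof. by split=> [c k b b'|b k c c'] /=; rewrite ?(tensDl, tensZl, tensDr, tensZr). Qed.

Lemma tassocV_is_bilinear A B C : bilinear_for *:%R *:%R
  (fun (a : A) (y : (B ⊗ C)%type) => tlift (fun b c => (a ⊗ b) ⊗ c) y).
Proof.
split=> [y k a a'|a] /=; last exact/tlift_is_linear/tassocV_in_is_bilinear.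
rewrite /tlift scaler_sumr -big_split /=; apply: eq_bigr => p _.
by rewrite !(tensDl, tensZl).
Qed.

HB.instance Definition _ A B C :=
  GRing.isLinear.Build K ((A ⊗ B) ⊗ C)%type (A ⊗ (B ⊗ C))%type *:%R (@tassoc A B C)
    (tlift_is_linear (tassoc_is_bilinear A B C)).
HB.instance Definition _ A B C :=
  GRing.isLinear.Build K (A ⊗ (B ⊗ C))%type ((A ⊗ B) ⊗ C)%type *:%R (@tassocV A B C)
    (tlift_is_linear (tassocV_is_bilinear A B C)).

Lemma tassocE A B C (a : A) (b : B) (c : C) :
  tassoc ((a ⊗ b) ⊗ c) = a ⊗ (b ⊗ c).
Proof.
rewrite /tassoc (tlift_tens (tassoc_is_bilinear A B C)).
exact/tlift_tens/tassoc_in_is_bilinear.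
Qed.

Lemma tassocVE A B C (a : A) (b : B) (c : C) :
  tassocV (a ⊗ (b ⊗ c)) = (a ⊗ b) ⊗ c.
Proof.
rewrite /tassocV (tlift_tens (tassocV_is_bilinear A B C)).
exact/tlift_tens/tassocV_in_is_bilinear.
Qed.

(* I ⊗ τ ⊗ I, with the associativity identifications written out. *)
Definition tmid A B C D : ((A ⊗ B) ⊗ (C ⊗ D))%type -> ((A ⊗ C) ⊗ (B ⊗ D))%type :=
  @tassocV A C (B ⊗ D)%type
  \o tmap idfun (@tassoc C B D \o tmap (@tflip B C) idfun \o @tassocV B C D)
  \o @tassoc A B (C ⊗ D)%type.
HB.instance Definition _ A B C D :=
  GRing.Linear.copy (@tmid A B C D)
   (@tassocV A C (B ⊗ D)%type
  \o tmap idfun (@tassoc C B D \o tmap (@tflip B C) idfun \o @tassocV B C D)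
  \o @tassoc A B (C ⊗ D)%type).

Lemma tmidE A B C D (a : A) (b : B) (c : C) (d : D) :
  tmid ((a ⊗ b) ⊗ (c ⊗ d)) = (a ⊗ c) ⊗ (b ⊗ d).
Proof. by rewrite /tmid /= tassocE tmapE /= tassocVE tmapE /= tflipE tassocE tassocVE. Qed.

End TensorMaps.

(* Unital associative K-algebras. Unlike algType, this allows the zero        *)
(* algebra; pzRingType and lmodType are only joined below algType, where      *)
(* 1 != 0 holds, so the product gets its own notation.                        *)
HB.mixin Record isAssocAlgebra (K : fieldType) A of GRing.Lmodule K A := {
  amul : A -> A -> A;
  aone : A;
  amulA : associative amul;
  amul1l : left_id aone amul;
  amul1r : right_id aone amul;
  amulDl : left_distributive amul +%R;
  amulDr : right_distributive amul +%R;
  ascaleAl : forall (k : K) (x y : A), k *: amul x y = amul (k *: x) y;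
  ascaleAr : forall (k : K) (x y : A), k *: amul x y = amul x (k *: y)
}.

#[short(type="assocAlgType")]
HB.structure Definition AssocAlgebra (K : fieldType) :=
  {A of GRing.Lmodule K A & isAssocAlgebra K A}.

Notation "x ∙ y" := (amul x y) : ring_scope.

Section TensorAlgebra.
Context {K : fieldType}.
Implicit Types A B : assocAlgType K.

Definition tmult A : (A ⊗ A)%type -> A := tlift amul.

Lemma tmult_is_bilinear A : bilinear_for *:%R *:%R (amul : A -> A -> A).
Proof.
by split=> x a y z /=; rewrite ?amulDl ?amulDr -?ascaleAl -?ascaleAr.
Qed.

HB.instance Definition _ A := GRing.isLinear.Build K (A ⊗ A)%type A *:%R
  (@tmult A) (tlift_is_linear (tmult_is_bilinear A)).

Lemma tmultE A (x y : A) : tmult (x ⊗ y) = x ∙ y.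
Proof. exact: (tlift_tens (tmult_is_bilinear A)). Qed.

Context {A B : assocAlgType K}.
Implicit Types x y z : A ⊗ B.

(* (a ⊗ b) ∙ (a' ⊗ b') = (a ∙ a') ⊗ (b ∙ b') *)
Definition tmul x y : A ⊗ B := tmap (@tmult A) (@tmult B) (tmid (x ⊗ y)).

Lemma tmulE (a a' : A) (b b' : B) :
  tmul (a ⊗ b) (a' ⊗ b') = (a ∙ a') ⊗ (b ∙ b').
Proof. by rewrite /tmul tmidE tmapE /= !tmultE. Qed.

Lemma tmulDl : left_distributive tmul +%R.
Proof. by move=> x y z; rewrite /tmul tensDl !linearD. Qed.

Lemma tmulDr : right_distributive tmul +%R.
Proof. by move=> x y z; rewrite /tmul tensDr !linearD. Qed.

Lemma tmul_scaleAl (k : K) x y : k *: tmul x y = tmul (k *: x) y.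
Proof. by rewrite /tmul tensZl !linearZ. Qed.

Lemma tmul_scaleAr (k : K) x y : k *: tmul x y = tmul x (k *: y).
Proof. by rewrite /tmul tensZr !linearZ. Qed.

Lemma tmul0l y : tmul 0 y = 0.
Proof. by rewrite -[X in tmul X y](scale0r 0) -tmul_scaleAl scale0r. Qed.

Lemma tmul0r x : tmul x 0 = 0.
Proof. by rewrite -[X in tmul x X](scale0r 0) -tmul_scaleAr scale0r. Qed.

Lemma tmulA : associative tmul.
Proof.
move=> x y z.
elim/tens_ind: x => [a b||? ? IH IH']; last by rewrite !tmulDl IH IH'.
  elim/tens_ind: y => [a' b'||? ? IH IH'].
  - elim/tens_ind: z => [a'' b''||? ? IH IH']; last by rewrite !tmulDr IH IH'.
      by rewrite !tmulE !amulA.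
    by rewrite !tmul0r.
  - by rewrite tmul0l !tmul0r tmul0l.
  - by rewrite tmulDl !tmulDr tmulDl IH IH'.
by rewrite !tmul0l.
Qed.

Lemma tmul1l : left_id (aone ⊗ aone) tmul.
Proof.
elim/tens_ind=> [a b||x y IH IH']; first by rewrite tmulE !amul1l.
  exact: tmul0r.
by rewrite tmulDr IH IH'.
Qed.

Lemma tmul1r : right_id (aone ⊗ aone) tmul.
Proof.
elim/tens_ind=> [a b||x y IH IH']; first by rewrite tmulE !amul1r.
  exact: tmul0l.
by rewrite tmulDl IH IH'.
Qed.

HB.instance Definition _ := isAssocAlgebra.Build K (A ⊗ B)%type
  tmulA tmul1l tmul1r tmulDl tmulDr tmul_scaleAl tmul_scaleAr.

End TensorAlgebra.

HB.mixin Record isCoalgebra (K : fieldType) C of GRing.Lmodule K C := {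
  comul : {linear C -> (C ⊗ C)%type};
  counit : {linear C -> K^o};
  comulA : forall c : C,
    tassoc (tmap comul idfun (comul c)) = tmap idfun comul (comul c);
  comul_counitl : forall c : C, tlunit (tmap counit idfun (comul c)) = c;
  comul_counitr : forall c : C, trunit (tmap idfun counit (comul c)) = c
}.

#[short(type="coalgType")]
HB.structure Definition Coalgebra (K : fieldType) :=
  {C of GRing.Lmodule K C & isCoalgebra K C}.

#[short(type="algCoalgType")]
HB.structure Definition AlgCoalgebra (K : fieldType) :=
  {H of AssocAlgebra K H & Coalgebra K H}.

(* counitM12 and counitM21 : ε(hkl) = ε(h k_1) ε(k_2 l) = ε(h k_2) ε(k_1 l).  *)
(* comul1l and comul1r are equations in (H ⊗ H) ⊗ H.                          *)
HB.mixin Record isWeakBialgebra (K : fieldType) H of AlgCoalgebra K H := {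
  comulM : forall h k : H, comul (h ∙ k) = comul h ∙ comul k;
  counitM12 : forall h k l : H, counit (h ∙ k ∙ l) =
    tlift (fun k1 k2 => counit (h ∙ k1) * counit (k2 ∙ l) : K^o) (comul k);
  counitM21 : forall h k l : H, counit (h ∙ k ∙ l) =
    tlift (fun k1 k2 => counit (h ∙ k2) * counit (k1 ∙ l) : K^o) (comul k);
  comul1l :
    tassocV (aone ⊗ comul (aone : H)) ∙ (comul (aone : H) ⊗ aone) =
    tmap comul idfun (comul (aone : H));
  comul1r :
    (comul (aone : H) ⊗ aone) ∙ tassocV (aone ⊗ comul (aone : H)) =
    tmap comul idfun (comul (aone : H))
}.

#[short(type="weakBialgType")]
HB.structure Definition WeakBialgebra (K : fieldType) :=
  {H of AlgCoalgebra K H & isWeakBialgebra K H}.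

(* ε_t(h) = ε(1_1 h) 1_2 and ε_s(h) = 1_1 ε(h 1_2) *)
Definition counit_t (K : fieldType) (H : weakBialgType K) (h : H) : H :=
  tlift (fun u1 u2 => counit (u1 ∙ h) *: u2) (comul (aone : H)).

Definition counit_s (K : fieldType) (H : weakBialgType K) (h : H) : H :=
  tlift (fun u1 u2 => counit (h ∙ u2) *: u1) (comul (aone : H)).

Lemma counit_t_is_linear (K : fieldType) (H : weakBialgType K) :
  GRing.linear_for *:%R (@counit_t K H).
Proof.
move=> a h k; rewrite /counit_t /tlift scaler_sumr -big_split /=.
apply: eq_bigr => p _; rewrite amulDr -ascaleAr linearD linearZ /=.
by rewrite scalerDl -scalerA.
Qed.

Lemma counit_s_is_linear (K : fieldType) (H : weakBialgType K) :
  GRing.linear_for *:%R (@counit_s K H).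
Proof.
move=> a h k; rewrite /counit_s /tlift scaler_sumr -big_split /=.
apply: eq_bigr => p _; rewrite amulDl -ascaleAl linearD linearZ /=.
by rewrite scalerDl -scalerA.
Qed.

HB.instance Definition _ (K : fieldType) (H : weakBialgType K) :=
  GRing.isLinear.Build K H H *:%R (@counit_t K H) (@counit_t_is_linear K H).
HB.instance Definition _ (K : fieldType) (H : weakBialgType K) :=
  GRing.isLinear.Build K H H *:%R (@counit_s K H) (@counit_s_is_linear K H).

HB.mixin Record hasAntipode (K : fieldType) H of WeakBialgebra K H := {
  antipode : {linear H -> H};
  antipodel : forall h : H,
    tlift (fun h1 h2 => h1 ∙ antipode h2) (comul h) = counit_t h;
  antipoder : forall h : H,
    tlift (fun h1 h2 => antipode h1 ∙ h2) (comul h) = counit_s h;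
  antipodelr : forall h : H,
    tlift (fun h12 h3 =>
      tlift (fun h1 h2 => antipode h1 ∙ h2 ∙ antipode h3) h12)
      (tmap comul idfun (comul h)) = antipode h
}.

#[short(type="weakHopfAlgType")]
HB.structure Definition WeakHopfAlgebra (K : fieldType) :=
  {H of WeakBialgebra K H & hasAntipode K H}.

Record is_comodule_coalgebra (K : fieldType) (H : weakHopfAlgType K)
    (C : coalgType K) (rho : {linear C -> (H ⊗ C)%type}) : Prop :=
  IsComoduleCoalgebra {
    coact_counit : forall c : C, tlunit (tmap counit idfun (rho c)) = c;
    coact_comul : forall c : C,
      tmap idfun comul (rho c) =
      tmap (@tmult K H) idfun (tmid (tmap rho rho (comul c)));
    coact_coassoc : forall c : C,
      tmap idfun rho (rho c) = tassoc (tmap comul idfun (rho c));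
    coact_counit_t : forall c : C,
      tmap idfun counit (rho c) = tmap (@counit_t K H) counit (rho c)
  }.

Definition const_coaction (K : fieldType) (H : weakHopfAlgType K)
  (C : coalgType K) (h : H) : C -> (H ⊗ C)%type := fun c => h ⊗ c.
Arguments const_coaction {K H} C h _.

HB.instance Definition _ (K : fieldType) (H : weakHopfAlgType K)
    (C : coalgType K) (h : H) :=
  GRing.Linear.copy (@const_coaction K H C h) (tens h).

(* Main.v *)
From HB Require Import structures.
Require Import Defs.
From mathcomp Require Import all_boot all_order all_algebra.
Set Implicit Arguments.
Unset Strict Implicit.
Unset Printing Implicit Defensive.
Import GRing.Theory.
Local Open Scope ring_scope.

(** For the constant coaction, the comodule coalgebra axioms are equations in
    [h] tensored with an element built from [c]: (CC1) reads ε(h) c = c, (CC2)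
    reads h ⊗ Δ(c) = h² ⊗ Δ(c), (CC3) reads h ⊗ h ⊗ c = Δ(h) ⊗ c and (CC4)
    reads ε(c) h = ε(c) ε_t(h). A nonzero coalgebra has an element [c] with
    ε(c) != 0 ([counit_neq0]), and on such a [c] the second tensor factor can
    be cancelled ([tens_cancelr]), so (CC1)-(CC3) give (i)-(iii).

    Conversely (i)-(iii) give (CC1)-(CC3) at once, and (CC4) amounts to
    ε_t(h) = h ([counit_t_grouplike]). This follows by computing h ε_t(h) in
    two ways. As h is grouplike, the antipode axiom gives ε_t(h) = h S(h), so
    h ε_t(h) = h² S(h) = ε_t(h). On the other hand, every weak bialgebra
    satisfies h_1 ⊗ ε_t(h_2) = 1_1 h ⊗ 1_2 ([comul_counit_t]), which here reads
    h ⊗ ε_t(h) = Δ(1) (h ⊗ 1); multiplying on the left by h ⊗ h = Δ(h) and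
    using Δ(h) Δ(1) = Δ(h) gives h ⊗ h ε_t(h) = h ⊗ h, hence h ε_t(h) = h. *)

Section TensorCancellation.
Context {K : fieldType}.
Implicit Types U V W : lmodType K.

Lemma linear_for0 V W (f : V -> W) : GRing.linear_for *:%R f -> f 0 = 0.
Proof.
by move=> fl; have /= := fl (-1) 0 0; rewrite scaler0 addr0 scaleN1r addNr.
Qed.

Lemma tassocK U V W : cancel (@tassoc K U V W) (@tassocV K U V W).
Proof.
elim/tens_ind=> [x w||x y IHx IHy].
- elim/tens_ind: x => [u v||x y IHx IHy].
  + by rewrite tassocE tassocVE.
  + by rewrite linear0l !linear0.
  + by rewrite tensDl !linearD /= IHx IHy.
- by rewrite !linear0.
- by rewrite !linearD /= IHx IHy.
Qed.

(** A linear form with nonzero value at [w] is assumed, rather than [w != 0],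
    so that no linear form has to be extended from the line of [w]. *)
Lemma tens_cancelr V W (f : {linear W -> K^o}) (w : W) :
  f w != 0 -> injective (fun v : V => v ⊗ w).
Proof.
move=> fw v v' /(congr1 (fun x => trunit (tmap idfun f x))).
by rewrite !tmapE !trunitE; apply: scalerI.
Qed.

End TensorCancellation.

(** In c = c_1 ε(c_2), some scalar must be nonzero if [c] is. *)
Lemma counit_neq0 (K : fieldType) (C : coalgType K) :
  (exists c : C, c != 0) -> exists c : C, counit c != 0.
Proof.
case=> c c0; have [s Dc] := tens_sumP (comul c).
have [/hasP[p _ p0]|/hasPn s0] := boolP (has (fun p => counit p.2 != 0) s).
  by exists p.2.
case/negP: c0; rewrite -(comul_counitr c) Dc; apply/eqP.
rewrite (linear_sum (tmap idfun counit)) (linear_sum (@trunit K C)) /=.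
rewrite big_seq big1 // => p /s0.
by rewrite negbK tmapE trunitE => /eqP /= ->; rewrite scale0r.
Qed.

Section AssocAlgebraTheory.
Context {K : fieldType}.

HB.instance Definition _ (A : assocAlgType K) :=
  bilinear_isBilinear.Build K A A A *:%R *:%R amul (tmult_is_bilinear A).

Lemma amul0l (A : assocAlgType K) (x : A) : 0 ∙ x = 0.
Proof. exact: linear0l. Qed.

Lemma amul0r (A : assocAlgType K) (x : A) : x ∙ 0 = 0.
Proof. exact: linear0r. Qed.

Lemma tens0l (V W : lmodType K) (w : W) : (0 : V) ⊗ w = 0.
Proof. exact: linear0l. Qed.

Lemma tens0r (V W : lmodType K) (v : V) : v ⊗ (0 : W) = 0.
Proof. exact: linear0r. Qed.

Lemma tens_amul (A B : assocAlgType K) (a a' : A) (b b' : B) :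
  (a ⊗ b) ∙ (a' ⊗ b') = (a ∙ a') ⊗ (b ∙ b').
Proof. exact: tmulE. Qed.

End AssocAlgebraTheory.

Section WeakBialgebraTheory.
Context {K : fieldType} {H : weakBialgType K}.

(** The contraction of the middle factor, through which the axioms on Δ²(1),
    equations in H ⊗ H ⊗ H, yield the identity [comul_counit_t] in H ⊗ H. *)
Definition counit_mid : ((H ⊗ H) ⊗ H)%type -> (H ⊗ H)%type :=
  tmap (@trunit K H \o tmap idfun counit) idfun.
HB.instance Definition _ := GRing.Linear.copy counit_mid
  (tmap (@trunit K H \o tmap idfun counit) idfun).

Lemma counit_midE (x y z : H) :
  counit_mid ((x ⊗ y) ⊗ z) = (counit y : K) *: (x ⊗ z).
Proof. by rewrite /counit_mid tmapE /= tmapE trunitE tensZl. Qed.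

Lemma counit_mid_comul (x : (H ⊗ H)%type) :
  counit_mid (tmap comul idfun x) = x.
Proof.
elim/tens_ind: x => [a b||x y IHx IHy].
- by rewrite /counit_mid !tmapE /= comul_counitr.
- by rewrite !linear0.
- by rewrite !linearD /= IHx IHy.
Qed.

Lemma counit_t_bilinear (h : H) :
  bilinear_for *:%R *:%R (fun u1 u2 : H => (counit (u1 ∙ h) : K) *: u2).
Proof.
split=> [v k u u'|u k v v'] /=.
  by rewrite amulDl -ascaleAl linearP scalerDl scalerA.
by rewrite scalerDr !scalerA mulrC.
Qed.

Lemma counit_mid_aone (x : (H ⊗ H)%type) :
  counit_mid (tassocV (aone ⊗ comul (aone : H)) ∙ (x ⊗ aone)) =
  tmap idfun (@counit_t K H) x.
Proof.
elim/tens_ind: x => [a b||x y IHx IHy].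
- rewrite tmapE /= /counit_t; have tl := tlift_is_linear (counit_t_bilinear b).
  elim/tens_ind: (comul aone) => [u v||y z IHy IHz].
  + rewrite tassocVE !tens_amul amul1l amul1r counit_midE.
    by rewrite (tlift_tens (counit_t_bilinear b)) tensZr.
  + rewrite tens0r !linear0 amul0l linear0.
    by rewrite (linear_for0 tl) tens0r.
  + have /= := tl 1 y z; rewrite !scale1r => ->.
    by rewrite tensDr linearD amulDl linearD /= IHy IHz tensDr.
- by rewrite tens0l amul0r !linear0.
- by rewrite tensDl amulDr !linearD /= IHx IHy.
Qed.

Lemma tmap_comulM (x : (H ⊗ H)%type) (h : H) :
  tmap comul idfun (x ∙ (h ⊗ aone)) = tmap comul idfun x ∙ (comul h ⊗ aone).
Proof.
elim/tens_ind: x => [a b||x y IHx IHy].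
- by rewrite tens_amul !tmapE /= tens_amul comulM.
- by rewrite amul0l linear0 amul0l.
- by rewrite !(linearD, amulDl) /= IHx IHy.
Qed.

(** The identity h_1 ⊗ ε_t(h_2) = 1_1 h ⊗ 1_2: inserting Δ(h) = Δ(1) Δ(h) in
    h_1 ⊗ ε(1_1 h_2) 1_2, the weak comultiplicativity of the unit turns the
    two copies of Δ(1) into Δ²(1) = 1_1 ⊗ 1_2 ⊗ 1_3, and 1_1 h_1 ε(1_2 h_2) ⊗ 1_3
    collapses to 1_1 h ⊗ 1_2 by multiplicativity of Δ and the counit axiom. *)
Lemma comul_counit_t (h : H) :
  tmap idfun (@counit_t K H) (comul h) = comul (aone : H) ∙ (h ⊗ aone).
Proof.
rewrite -counit_mid_aone -{1}(amul1l h) comulM.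
rewrite -[X in (_ ∙ _) ⊗ X]amul1l -tens_amul amulA comul1l.
by rewrite -tmap_comulM counit_mid_comul.
Qed.

End WeakBialgebraTheory.

(** The left factor [h] is what makes Δ(1) disappear from h ⊗ ε_t(h) =
    Δ(1) (h ⊗ 1): multiplied on the left by h ⊗ h = Δ(h), it is absorbed. *)
Lemma amul_counit_t_grouplike (K : fieldType) (H : weakBialgType K) (h : H) :
  counit h = 1 -> h ∙ h = h -> comul h = h ⊗ h -> h ∙ counit_t h = h.
Proof.
move=> eh hh Dh; have := comul_counit_t h.
rewrite Dh tmapE /= => /(congr1 (amul (comul h))).
rewrite amulA -comulM amul1r Dh !tens_amul amul1r hh.
move/(congr1 (fun x => tlunit (tmap counit idfun x))).
by rewrite !tmapE !tlunitE eh !scale1r.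
Qed.

(** As ε_t(h) = h S(h), multiplying it by [h] on the left does not change it. *)
Lemma counit_t_grouplike (K : fieldType) (H : weakHopfAlgType K) (h : H) :
  counit h = 1 -> h ∙ h = h -> comul h = h ⊗ h -> counit_t h = h.
Proof.
move=> eh hh Dh; rewrite -[RHS](amul_counit_t_grouplike eh hh Dh) -antipodel Dh.
rewrite tlift_tens ?amulA ?hh //.
by split=> x a y z /=; rewrite ?linearP ?amulDl ?amulDr -?ascaleAl -?ascaleAr.
Qed.

Lemma tmult_const_coaction (K : fieldType) (H : weakHopfAlgType K)
    (C : coalgType K) (h : H) (x : (C ⊗ C)%type) :
  tmap (@tmult K H) idfun
    (tmid (tmap (const_coaction C h) (const_coaction C h) x)) = (h ∙ h) ⊗ x.
Proof.
elim/tens_ind: x => [c d||x y IHx IHy].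
- by rewrite tmapE tmidE tmapE /= tmultE.
- by rewrite !linear0.
- by rewrite !linearD /= IHx IHy.
Qed.

Theorem proposition3p7 (K : fieldType) (H : weakHopfAlgType K)
    (C : coalgType K) (C_neq0 : exists c : C, c != 0) (h : H) :
  is_comodule_coalgebra (const_coaction C h) <->
  [/\ counit h = 1, h ∙ h = h & comul h = h ⊗ h].
Proof.
split=> [[cc1 cc2 cc3 _]|[eh hh Dh]].
- have [c ec] := counit_neq0 C_neq0.
  split.
  + have := congr1 counit (cc1 c); rewrite tmapE tlunitE linearZ /=.
    by rewrite -[RHS]mul1r; apply: mulIf.
  + (* The functional ε ⊗ ε does not vanish on Δ(c), as (ε ⊗ ε) Δ = ε. *)
    have := cc2 c; rewrite tmult_const_coaction tmapE /= => /esym.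
    apply: (tens_cancelr (f := counit \o (@trunit K C \o tmap idfun counit))).
    by rewrite /= comul_counitr.
  + have := congr1 (@tassocV K H H C) (cc3 c).
    rewrite tassocK !tmapE /= tassocVE => /esym.
    exact: (tens_cancelr (f := counit)) ec _ _.
- split=> c; rewrite ?tmult_const_coaction tmapE /=.
  + by rewrite tlunitE eh scale1r.
  + by rewrite hh.
  + by rewrite tmapE /= Dh tassocE.
  + by rewrite tmapE /= counit_t_grouplike.
Qed.
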